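(* Let $\mathcal{A}_0=\{(\delta_0,0),(F_0,c_0)\}$ with $\mathbb{E}_{F_0}[y]=1$ and $0\le c_0<1$. Let $\alpha^*=\alpha^*(c_0)\in[0,1)$ be the unique solution of $\alpha^*+\ln(1-\alpha^* )\cdot(1-\alpha^* )=c_0$. Then the optimal randomized worst-case payoff is $$\max_{\alpha}\frac{\alpha-c_0}{-\ln(1-\alpha)}=\frac{\alpha^*-c_0}{-\ln(1-\alpha^* )}=1-\alpha^*,$$ while the optimal deterministic worst-case payoff is $(1-\sqrt{c_0})^2$, so the ratio of the optimal randomized payoff to the optimal deterministic payoff is $\frac{1-\alpha^*(c_0)}{(1-\sqrt{c_0})^2}$, and $$\lim_{c_0\to1^-}\frac{1-\alpha^*(c_0)}{(1-\sqrt{c_0})^2}=+\infty.$$ In particular, the advantage of randomized contracts over deterministic contracts can be arbitrarily large even when the principal knows only one non-trivial action. (When $c_0=0$, so that $\alpha^*=0$, the quotients in the display at $\alpha=0$ are understood as limits as $\alpha\to0^+$.)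
   Context: Outcome space: $\mathcal{Y}\subset\mathbb{R}_+$ is compact with $0\in\mathcal{Y}$; $\Delta(\mathcal{Y})$ is the set of Borel probability distributions on $\mathcal{Y}$; $\delta_0$ is the point mass at $0$. An action is a pair $(F,c)\in\Delta(\mathcal{Y})\times\mathbb{R}_+$ (outcome distribution, cost). A technology is a set $\mathcal{A}\subseteq\Delta(\mathcal{Y})\times\mathbb{R}_+$ of actions. A (deterministic) contract is a bounded Borel function $w:\mathcal{Y}\to\mathbb{R}_+$; a randomized contract is a probability distribution $G$ over contracts. Given $w$, the agent's utility from action $a=(F,c)$ is $u(w,a)=\mathbb{E}_F[w(y)]-c$, and the agent takes an action in $\operatorname{argmax}_{a\in\mathcal{A}}u(w,a)$, breaking ties in favor of the principal. The principal knows only $\mathcal{A}_0$; the true technology $\mathcal{A}\supseteq\mathcal{A}_0$ is chosen adversarially knowing $G$ but not the realization of $w$. Only technologies for which a maximizer exists for $G$-almost every $w$ are considered. The worst-case payoff of $G$ is $$\inf_{\mathcal{A}\supseteq\mathcal{A}_0}\mathbb{E}_{w\sim G}\Big[\sup_{(F,c)\in\operatorname{argmax}_{a\in\mathcal{A}}u(w,a)}\mathbb{E}_F[y-w(y)]\Big].$$ The optimal randomized worst-case payoff is the supremum of this quantity over all randomized contracts $G$; the optimal deterministic worst-case payoff is the supremum over all $G$ that are point masses on a single contract $w$. *)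

(* Defs.v *)
From HB Require Import structures.
From mathcomp Require Export all_boot all_order all_algebra.
From mathcomp Require Export all_classical all_reals all_analysis.

Set Implicit Arguments.
Unset Strict Implicit.
Unset Printing Implicit Defensive.

Import Order.TTheory GRing.Theory Num.Theory numFieldNormedType.Exports.
Local Open Scope classical_set_scope.
Local Open Scope ring_scope.

(* A Borel function on the compact set [Y] is encoded by its extension by 0 to
   the real line; [contract_out] makes this representative unique, so that
   [contract Y] is in bijection with the contracts on [Y]. *)
Record contract (R : realType) (Y : set R) := Contract {
  contract_fun :> measurableTypeR R -> R ;
  contract_measurable : measurable_fun [set: measurableTypeR R] contract_fun ;
  contract_ge0 : forall y, 0 <= contract_fun y ;
  contract_bounded : exists M : R, forall y, contract_fun y <= M ;
  contract_out : forall y, ~ Y y -> contract_fun y = 0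
}.

Section zero_contract.
Variables (R : realType) (Y : set R).

Let zero_bounded : exists M : R, forall y : R, (cst 0 : R -> R) y <= M.
Proof. by exists 0. Qed.

Definition zero_contract : contract Y :=
  @Contract R Y (cst 0) (measurable_cst _) (fun=> lexx 0) zero_bounded
    (fun _ _ => erefl).

HB.instance Definition _ := gen_eqMixin (contract Y).
HB.instance Definition _ := gen_choiceMixin (contract Y).
HB.instance Definition _ := isPointed.Build (contract Y) zero_contract.

End zero_contract.

(* The open sets of contracts for the sup-norm distance. *)
Definition sup_open (R : realType) (Y : set R) : set (set (contract Y)) :=
  [set U : set (contract Y) | forall w : contract Y, U w ->
     exists2 e : R, 0 < e &
       forall w' : contract Y, (forall y, `|w y - w' y| < e) -> U w'].

(* The space of contracts with the Borel sigma-algebra of the sup norm. *)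
Definition contracts (R : realType) (Y : set R) :=
  g_sigma_algebraType (@sup_open R Y).

Definition randomized_contract (R : realType) (Y : set R) :=
  probability (contracts Y) R.

(* A distribution on [Y] is a Borel probability on the line giving mass 1 to
   [Y]; see [actions]. *)
Definition action (R : realType) : Type :=
  (probability (measurableTypeR R) R * R)%type.

Definition actions (R : realType) (Y : set R) : set (action R) :=
  [set a : action R | a.1 Y = 1%E /\ 0 <= a.2].

Definition agent_utility (R : realType) (Y : set R) (w : contract Y)
    (a : action R) : \bar R :=
  ('E_(a.1)[w] - a.2%:E)%E.

Definition agent_argmax (R : realType) (Y : set R) (A : set (action R))
    (w : contract Y) : set (action R) :=
  [set a : action R | A a /\
     forall b, A b -> (agent_utility w b <= agent_utility w a)%E].

(* The supremum over the argmax expresses tie-breaking for the principal. *)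
Definition principal_payoff (R : realType) (Y : set R) (A : set (action R))
    (w : contract Y) : \bar R :=
  ereal_sup [set 'E_(a.1)[fun y : measurableTypeR R => (y - w y : R)%R]%E
            | a in agent_argmax A w].

Definition admissible (R : realType) (Y : set R) (A0 : set (action R))
    (G : randomized_contract Y) : set (set (action R)) :=
  [set A | [/\ A0 `<=` A, A `<=` actions Y &
     {ae G, forall w, agent_argmax A w !=set0}]].

(* No measurability is imposed on the adversary's technologies.  The integral
   is total: it is the expectation when the payoff is measurable up to a
   [G]-null set, and otherwise lies between the lower and the upper
   expectation of the payoff. *)
Definition worst_case (R : realType) (Y : set R) (A0 : set (action R))
    (G : randomized_contract Y) : \bar R :=
  ereal_inf [set (\int[G]_w principal_payoff A w)%E | A in admissible A0 G].

Definition opt_randomized (R : realType) (Y : set R) (A0 : set (action R)) :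
    \bar R :=
  ereal_sup [set worst_case A0 G | G in [set: randomized_contract Y]].

Definition point_mass (R : realType) (Y : set R) (w : contracts Y) :
    randomized_contract Y :=
  @dirac _ (contracts Y) w R.

Definition opt_deterministic (R : realType) (Y : set R)
    (A0 : set (action R)) : \bar R :=
  ereal_sup [set worst_case A0 (point_mass w) | w in [set: contracts Y]].

Definition null_action (R : realType) : action R :=
  (@dirac _ (measurableTypeR R) 0 R : probability _ R, 0).

Definition two_actions (R : realType) (F0 : probability (measurableTypeR R) R)
    (c0 : R) : set (action R) :=
  [set null_action R; (F0, c0)].

Definition alpha_star_eq (R : realType) (c0 a : R) : Prop :=
  0 <= a < 1 /\ a + ln (1 - a) * (1 - a) = c0.

(* The default value 0 is only used if [alpha_star_eq c0] has no solution. *)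
Definition alpha_star (R : realType) (c0 : R) : R :=
  xget 0 [set a | alpha_star_eq c0 a].

(* (a - c0) / - ln (1 - a) on [0, 1), the undefined quotient at a = 0 being read
   as the limit a -> 0+ in the extended reals (1 if c0 = 0, -oo if c0 > 0). *)
Definition alpha_quotient (R : realType) (c0 a : R) : \bar R :=
  if a == 0 then lim (((b - c0) / - ln (1 - b))%:E @[b --> 0^'+])
  else ((a - c0) / - ln (1 - a))%:E.

(* Main.v *)
(* Upper bound: put v = 1 - alpha_star.  The technology consisting of the null
   action and of the mixtures (1 - x) delta_0 + x F0, v <= x <= 1, at cost
   x - v - v ln (x / v), contains the known actions and leaves at most v to the
   principal for every single contract w: only the slope b = E_F0[w] - w(0)
   matters, the agent chooses x = v / (1 - b) (or x = 1 if this exceeds 1), and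
   the principal gets at most x (1 - b).

   Lower bound: the ideal contract pays a * y where a has density proportional
   to 1 / (1 - a) on [0, alpha_star].  It is discretised as the uniform law on
   the slopes a_k = 1 - q ^ (k + 1), k < n, with q ^ n = 1 - alpha_star.  If x_k
   is the mean outcome chosen at a_k, optimality of the agent bounds the
   increment of his value between consecutive slopes by (a_k - a_(k-1)) x_k, so
   that \sum_k (a_k - a_(k-1)) x_k >= alpha_star - c0, and this sum is
   proportional to the principal's payoff \sum_k (1 - a_k) x_k / n.  A finite
   support also makes the measurability of the payoff irrelevant.

   Deterministic contracts: a linear contract of slope sqrt c0 guarantees
   (1 - sqrt c0)^2, and if b >= c0 a free mixture with x slightly above
   (b - c0) / b makes the agent abandon F0. *)
Require Import Defs.
From HB Require Import structures.
From mathcomp Require Import measurable_realfun ring lra.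

Set Implicit Arguments.
Unset Strict Implicit.
Unset Printing Implicit Defensive.

Import Order.TTheory GRing.Theory Num.Theory numFieldNormedType.Exports.
Local Open Scope classical_set_scope.
Local Open Scope ring_scope.

(** * Integrals of possibly nonmeasurable functions *)

Section integral_nonmeasurable.
Local Open Scope ereal_scope.
Context d (T : measurableType d) (R : realType).
Implicit Types (mu : {measure set T -> \bar R}) (P : probability T R).

Import HBNNSimple.

(* The payoff need not be measurable, but the integral of a nonnegative function
   is a supremum over simple functions, hence monotone for all integrands. *)
Lemma ge0_le_integralT mu (f g : T -> \bar R) :
  (forall x, 0 <= f x) -> (forall x, f x <= g x) ->
  \int[mu]_x f x <= \int[mu]_x g x.
Proof.
move=> f0 fg; have g0 x : 0 <= g x by exact: le_trans (f0 x) (fg x).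
rewrite !ge0_integralTE//; apply: le_ereal_sup => _ [h /= hf <-].
by exists h => //= x; exact: le_trans (hf x) (fg x).
Qed.

(** Dropping the negative part only increases the integral, and a simple function below the positive
    part is at most [b] on [S], hence almost everywhere; [f] itself is never assumed measurable. *)
Lemma integral_le_of_full P (S : set T) (f : T -> \bar R) (b : R) :
  measurable S -> P S = 1 -> (0 <= b)%R ->
  (forall x, S x -> f x <= b%:E) -> \int[P]_x f x <= b%:E.
Proof.
move=> mS PS b0 fb.
rewrite integralE; apply: (@le_trans _ _ (\int[P]_x f^\+ x)).
  by rewrite -[leRHS]sube0 leeB// integral_ge0.
rewrite ge0_integralTE//; apply: ge_ereal_sup => _ [h /= hf <-].
rewrite -integralT_nnsfun.
have -> : b%:E = \int[P]_x (cst b%:E x).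
  by rewrite integral_cst//= probability_setT mule1.
apply: ae_ge0_le_integral => //.
- by move=> x _; rewrite lee_fin.
- exact/measurable_EFinP.
exists (~` S); split; first exact: measurableC.
- by rewrite [LHS](probability_setC P mS) PS subee.
- move=> x /= nh Sx; apply: nh => _.
  by rewrite (le_trans (hf x))// funeposE ge_max fb//= lee_fin.
Qed.

(** The negative part vanishes on [S], so its integral is 0 by the previous bound. The gain is that
    [f \_ S] may be measurable when [f] is not. *)
Lemma le_integral_of_full P (S : set T) (f : T -> \bar R) :
  measurable S -> P S = 1 -> (forall x, S x -> 0 <= f x) ->
  \int[P]_x (f \_ S) x <= \int[P]_x f x.
Proof.
move=> mS PS f0; rewrite [leRHS]integralE.
have -> : \int[P]_x f^\- x = 0.
  apply/eqP; rewrite eq_le integral_ge0// andbT.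
  apply: (integral_le_of_full mS PS) => // x Sx.
  by rewrite funenegE ge_max lexx andbT leeNl oppe0 f0.
rewrite sube0; apply: ge0_le_integralT => x; rewrite /patch; case: ifPn => //.
- by rewrite inE => /f0.
- by move=> _; rewrite funeposE le_max lexx.
- by rewrite funeposE le_max lexx orbT.
Qed.

End integral_nonmeasurable.

(** * Finite mixtures of probabilities *)

Section mixture.
Context d (T : measurableType d) (R : realType).
Variables (n : nat) (p : nat -> {nonneg R}) (P : nat -> probability T R).
Hypothesis p1 : \sum_(k < n) (p k)%:num = 1.

(* [p1] is recorded in the term so that the probability structure can be keyed
   on [mixture p1]. *)
Definition mixture : set T -> \bar R :=
  let _ := p1 in msum (fun k => mscale (p k) (P k)) n.

HB.instance Definition _ := Measure.copy mixture
  (msum (fun k => mscale (p k) (P k)) n).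

Let mixture_setT : mixture [set: T] = 1%E.
Proof.
rewrite /mixture /msum -[in RHS]p1 -sumEFin.
apply: eq_bigr => k _.
by rewrite -[RHS]mule1; congr (_ * _)%E; exact: probability_setT.
Qed.

HB.instance Definition _ :=
  Measure_isProbability.Build _ _ _ mixture mixture_setT.

Lemma ge0_integral_mixture (f : T -> \bar R) :
  measurable_fun [set: T] f -> (forall x, 0 <= f x)%E ->
  (\int[mixture]_x f x = \sum_(k < n) (p k)%:num%:E * \int[P k]_x f x)%E.
Proof.
move=> mf f0; rewrite [LHS]ge0_integral_measure_sum//.
by apply: eq_bigr => k _; rewrite ge0_integral_mscale.
Qed.

End mixture.

(** * Finitely supported probabilities *)

Section finitely_supported.
Local Open Scope ereal_scope.
Context d (T : measurableType d) (R : realType).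

(** Phrased through integrals so that point masses and mixtures of point masses are covered by one
    interface. *)
Definition finitely_supported (G : probability T R) n (p : nat -> R)
    (w : nat -> T) : Prop :=
  forall g : T -> \bar R, measurable_fun setT g -> (forall x, 0 <= g x) ->
    \int[G]_x g x = \sum_(k < n) (p k)%:E * g (w k).

Variables (G : probability T R) (n : nat) (p : nat -> R) (w : nat -> T).
Hypothesis GE : finitely_supported G n p w.
Hypothesis mT : forall t : T, measurable [set t].
Hypothesis p1 : (\sum_(k < n) p k = 1)%R.

Let S : set T := [set w k | k in `I_n].

Let measurable_sub_support (A : set T) : A `<=` S -> measurable A.
Proof.
move=> AS; apply: countable_measurable => //; apply: finite_set_countable.
by apply: sub_finite_set AS _; apply: finite_image; exact: finite_II.
Qed.

Lemma finitely_supported_measure (A : set T) : measurable A ->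
  G A = \sum_(k < n) (p k)%:E * (\1_A (w k))%:E.
Proof.
move=> mA; have := @GE (EFin \o \1_A).
rewrite integral_indic// setIT => -> //.
- exact/measurable_EFinP.
- by move=> x; rewrite /= lee_fin.
Qed.

(** A null set has total weight 0, so positive weights keep every atom outside it. *)
Lemma finitely_supported_ae (Q : T -> Prop) :
  (forall k, (k < n)%N -> 0 < p k)%R ->
  {ae G, forall x, Q x} -> forall k, (k < n)%N -> Q (w k).
Proof.
move=> p0 [N [mN GN QN]] k kn; apply: contrapT => nQ.
move: GN; rewrite [LHS](finitely_supported_measure mN).
under eq_bigr do rewrite -EFinM.
rewrite sumEFin => -[] /eqP; rewrite psumr_eq0 => [/allP/(_ (Ordinal kn))|i _].
  rewrite mem_index_enum => /(_ isT)/=.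
  by rewrite indicE mem_set ?mulr1 ?gt_eqF ?p0//; exact: QN.
by apply: mulr_ge0 => //; exact/ltW/p0.
Qed.

(** Every subset of the finite support is measurable, hence so is [f] restricted to it, and the
    support has full measure. *)
Lemma finitely_supported_integral_ge (f : T -> \bar R) :
  (forall k, (k < n)%N -> 0 <= f (w k)) ->
  \sum_(k < n) (p k)%:E * f (w k) <= \int[G]_x f x.
Proof.
move=> f0; have mS : measurable S by exact: measurable_sub_support.
have fS0 x : S x -> 0 <= f x by move=> [k /= kn <-]; exact: f0.
have GS : G S = 1.
  rewrite finitely_supported_measure// -p1 -sumEFin; apply: eq_bigr => k _.
  by rewrite indicE mem_set ?mule1//; exists k => /=.
apply: le_trans (le_integral_of_full mS GS fS0).
rewrite GE.
- rewrite le_eqVlt; apply/orP; left; apply/eqP; apply: eq_bigr => k _.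
  by rewrite patchE mem_set//; exists k => /=.
- apply/(measurable_restrictT _ mS) => _ B _.
  exact: measurable_sub_support (@subIsetl _ _ _).
- exact: erestrict_ge0.
Qed.

End finitely_supported.

Lemma finitely_supported_dirac d (T : measurableType d) (R : realType) (a : T) :
  finitely_supported (@dirac d T a R : probability T R) 1 (fun=> 1) (fun=> a).
Proof.
by move=> g mg g0; rewrite integral_dirac// diracT big_ord1.
Qed.

Lemma finitely_supported_mixture d (T : measurableType d) (R : realType) n
    (p : nat -> {nonneg R}) (w : nat -> T)
    (p1 : \sum_(k < n) (p k)%:num = 1) :
  finitely_supported
    (mixture (fun k => @dirac d T (w k) R : probability T R) p1)
    n (fun k => (p k)%:num) w.
Proof.
move=> g mg g0; rewrite ge0_integral_mixture//; apply: eq_bigr => k _.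
by rewrite integral_dirac// diracT mul1e.
Qed.

(** * The space of contracts *)

Section contracts.
Context (R : realType) (Y : set R).
Implicit Types (w : contract Y).

Lemma contract_ext w w' : (forall y, w y = w' y) -> w = w'.
Proof.
case: w w' => [f mf f0 bf f_out] [g mg g0 bg g_out] /= fg.
have {}fg : f = g by apply/funext.
rewrite -fg in mg g0 bg g_out *.
by congr Contract; exact: Prop_irrelevance.
Qed.

(** Singletons are closed for the sup norm: a contract differing from [w] at [y] has a ball, of
    radius the gap at [y], that misses [w]. *)
Lemma measurable_contract1 (w : contracts Y) : measurable [set w].
Proof.
rewrite -[X in measurable X]setCK; apply: measurableC.
apply: sub_sigma_algebra => w1 /= w1w.
have [y w1wy] : exists y, contract_fun w1 y <> contract_fun w y.
  by apply/existsNP => /contract_ext.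
exists `|contract_fun w1 y - contract_fun w y|.
  by rewrite normr_gt0 subr_eq0; exact/eqP.
by move=> w' ww' w'w; have := ww' y; rewrite w'w ltxx.
Qed.

End contracts.

(** * Linear contracts, expected payments and expected outcomes *)

Section outcomes.
Context (R : realType) (Y : set R).
Hypotheses (Y_compact : compact Y) (Y_ge0 : forall y, Y y -> 0 <= y).
Implicit Types (F : probability (measurableTypeR R) R) (w : contract Y).

Let mY : measurable (Y : set (measurableTypeR R)).
Proof. exact: compact_measurable. Qed.

Lemma outcome_bounded : exists2 M : R, 0 <= M & forall y, Y y -> y <= M.
Proof.
have [M [_ HM]] := compact_bounded Y_compact.
(* Only numbers strictly above [M] are known to bound [Y]. *)
exists (`|M| + 1) => [|y Yy]; first by rewrite addr_ge0.
apply: le_trans (ler_norm y) _; apply: (HM (`|M| + 1)) => //.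
by rewrite ltr_pwDr// ler_norm.
Qed.

(* Negative slopes are truncated to 0 so that the payment is always
   nonnegative. *)
Let lin_fun (a y : R) := if y \in Y then Num.max a 0 * y else 0.

Let lin_fun_measurable a :
  measurable_fun [set: measurableTypeR R] (lin_fun a : measurableTypeR R -> R).
Proof.
have -> : lin_fun a = ((fun y => Num.max a 0 * y) \_ Y).
  by apply/funext => y; rewrite /lin_fun patchE.
apply: (measurable_restrictT _ mY).1; apply: measurable_funTS.
exact: mulrl_measurable.
Qed.

Let lin_fun_ge0 a y : 0 <= lin_fun a y.
Proof.
rewrite /lin_fun; case: ifPn => //; rewrite inE => Yy.
by apply: mulr_ge0; [rewrite le_max lexx orbT|exact: Y_ge0].
Qed.

Let lin_fun_bounded a : exists M : R, forall y, lin_fun a y <= M.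
Proof.
have [M M0 YM] := outcome_bounded; exists (Num.max a 0 * M) => y.
have a0 : 0 <= Num.max a 0 by rewrite le_max lexx orbT.
rewrite /lin_fun; case: ifPn; last by rewrite mulr_ge0.
by rewrite inE => /YM yM; rewrite ler_wpM2l.
Qed.

Let lin_fun_out a y : ~ Y y -> lin_fun a y = 0.
Proof. by move=> Yy; rewrite /lin_fun memNset. Qed.

Definition linear_contract (a : R) : contract Y :=
  Contract (lin_fun_measurable a) (lin_fun_ge0 a) (lin_fun_bounded a)
    (@lin_fun_out a).

Lemma linear_contractE a y : 0 <= a -> Y y -> linear_contract a y = a * y.
Proof.
by move=> a0 Yy; rewrite /= /lin_fun mem_set//; congr (_ * _); exact/max_idPl.
Qed.

Lemma contract_Lfun F w : (w : _ -> _) \in Lfun F 1.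
Proof.
have [M wM] := contract_bounded w.
apply/Lfun1_integrable/integrableP; split.
  apply/measurable_EFinP; exact: contract_measurable.
apply: (@le_lt_trans _ _ (\int[F]_x (cst M%:E x))%E); last first.
  by rewrite integral_cst//= probability_setT mule1 ltry.
apply: ge0_le_integral => //.
- apply: measurableT_comp => //; apply/measurable_EFinP.
  exact: contract_measurable.
- by move=> x _ /=; rewrite lee_fin ger0_norm ?contract_ge0.
Qed.

Lemma eq_expectation_full F (f g : measurableTypeR R -> R) : F Y = 1%E ->
  measurable_fun setT f -> measurable_fun setT g ->
  (forall y, Y y -> f y = g y) -> 'E_F[f]%E = 'E_F[g]%E.
Proof.
move=> FY mf mg fg; rewrite unlock; apply: ae_eq_integral => //.
- exact/measurable_EFinP.
- exact/measurable_EFinP.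
exists (~` Y); split; first exact: measurableC.
- by rewrite [LHS](probability_setC F mY) FY subee.
- by move=> y /= nfg Yy; apply: nfg => _; rewrite fg.
Qed.

Definition mean_pay F w : R := fine 'E_F[w]%E.

Lemma expectation_contract F w : 'E_F[w]%E = (mean_pay F w)%:E.
Proof. by rewrite fineK// expectation_fin_num ?contract_Lfun. Qed.

Definition mean_outcome F : R :=
  fine 'E_F[fun y : measurableTypeR R => (y : R)]%E.

(** On [Y] the outcome is the payment of the contract of slope 1, so results on bounded contracts
    apply to the unbounded identity. *)
Lemma expectation_outcome_contract F : F Y = 1%E ->
  'E_F[fun y : measurableTypeR R => (y : R)]%E =
  'E_F[linear_contract 1]%E.
Proof.
move=> FY; apply: eq_expectation_full => //; first exact: contract_measurable.
by move=> y Yy; rewrite linear_contractE ?mul1r.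
Qed.

Lemma mean_outcomeE F : F Y = 1%E ->
  mean_outcome F = mean_pay F (linear_contract 1).
Proof. by move=> FY; rewrite /mean_outcome expectation_outcome_contract. Qed.

Lemma mean_pay_ge0 F w : 0 <= mean_pay F w.
Proof. by rewrite fine_ge0// expectation_ge0//; exact: contract_ge0. Qed.

Lemma mean_pay_linear F a : F Y = 1%E -> 0 <= a ->
  mean_pay F (linear_contract a) = a * mean_outcome F.
Proof.
move=> FY a0; apply: EFin_inj; rewrite EFinM -expectation_contract.
rewrite mean_outcomeE// -expectation_contract -expectationZl ?contract_Lfun//.
apply: eq_expectation_full => //.
- exact: contract_measurable.
- by apply: measurable_funM => //; exact: contract_measurable.
- move=> y Yy; rewrite linear_contractE// mulrC -[y in LHS]mul1r.
  by rewrite -(linear_contractE ler01 Yy).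
Qed.

Lemma expectation_profit F w : F Y = 1%E ->
  'E_F[fun y : measurableTypeR R => (y - w y : R)%R]%E =
  (mean_outcome F - mean_pay F w)%:E.
Proof.
move=> FY; rewrite EFinB mean_outcomeE// -!expectation_contract.
rewrite -expectationB ?contract_Lfun//.
apply: eq_expectation_full => //.
- by apply: measurable_funB => //; exact: contract_measurable.
- by apply: measurable_funB; exact: contract_measurable.
- move=> y Yy; transitivity (linear_contract 1 y - w y) => //.
  by rewrite linear_contractE// mul1r.
Qed.

Lemma agent_utilityE w (a : action R) :
  agent_utility w a = (mean_pay a.1 w - a.2)%:E.
Proof. by rewrite /agent_utility expectation_contract EFinB. Qed.

End outcomes.

(** * Technologies of mixtures, and bounds on the worst case *)

Section binary_technologies.
Context (R : realType) (Y : set R).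
Hypotheses (Y_compact : compact Y) (Y_ge0 : forall y, Y y -> 0 <= y)
  (Y_0 : Y 0).
Variable F0 : probability (measurableTypeR R) R.
Hypotheses (F0_Y : F0 Y = 1%E)
  (F0_mean : 'E_F0[fun y : measurableTypeR R => (y : R)]%E = 1%E).
Implicit Types (F : probability (measurableTypeR R) R) (w : contract Y).

Let mY : measurable (Y : set (measurableTypeR R)).
Proof. exact: compact_measurable. Qed.

(* Contracts cannot distinguish [F] from (1 - x) delta_0 + x F0. *)
Definition mixes (x : R) F : Prop :=
  F Y = 1%E /\
  forall w, mean_pay F w = (1 - x) * w 0 + x * mean_pay F0 w.

Lemma mixes_null : mixes 0 (null_action R).1.
Proof.
split => [|w]; first by rewrite /= diracE mem_set.
rewrite subr0 mul1r mul0r addr0 /mean_pay unlock integral_dirac//.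
  by rewrite diracT mul1e.
by apply/measurable_EFinP; exact: contract_measurable.
Qed.

Lemma mixes_known : mixes 1 F0.
Proof. by split => // w; rewrite subrr mul0r add0r mul1r. Qed.

Lemma mixes_exists x : 0 <= x <= 1 -> exists F, mixes x F.
Proof.
move=> /andP[x0 x1]; have y0 : 0 <= 1 - x by rewrite subr_ge0.
pose p k : {nonneg R} := if k is 0%N then NngNum y0 else NngNum x0.
pose P k : probability (measurableTypeR R) R :=
  if k is 0%N then (null_action R).1 else F0.
have p1 : \sum_(k < 2) (p k)%:num = 1.
  by rewrite !big_ord_recl big_ord0 /=; lra.
exists (mixture P p1); split => [|w].
  rewrite /= /mixture /msum !big_ord_recl big_ord0 /= /mscale/= F0_Y.
  by rewrite diracE mem_set// !mule1 adde0 -EFinD subrK.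
apply: EFin_inj; rewrite -expectation_contract unlock ge0_integral_mixture.
- have [_ /(_ w) null] := mixes_null.
  have := expectation_contract (null_action R).1 w.
  rewrite null subr0 mul1r mul0r addr0 unlock => e0.
  rewrite !big_ord_recl big_ord0 adde0 /= e0.
  have := expectation_contract F0 w; rewrite unlock => ->.
  by rewrite -!EFinM -EFinD.
- by apply/measurable_EFinP; exact: contract_measurable.
- by move=> y; rewrite lee_fin contract_ge0.
Qed.

Let mean_F0 : mean_outcome F0 = 1.
Proof. by rewrite /mean_outcome F0_mean. Qed.

Lemma mixes_mean_outcome x F : mixes x F -> mean_outcome F = x.
Proof.
move=> [FY Fw]; rewrite (mean_outcomeE Y_compact Y_ge0)// Fw.
rewrite -(mean_outcomeE Y_compact Y_ge0)// mean_F0 linear_contractE//.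
by rewrite !mulr0 add0r mulr1.
Qed.

(** A mixture of weight [x] is paid [w 0 + x * slope w], so this number, possibly negative, settles
    the choice among mixtures. *)
Definition slope w : R := mean_pay F0 w - w 0.

(* A technology of mixtures is described by the pairs (weight of F0, cost). *)
Definition mix_technology (X : set (R * R)) : set (action R) :=
  [set a | exists2 z, X z & mixes z.1 a.1 /\ a.2 = z.2].

Definition best_response (X : set (R * R)) (b : R) : set (R * R) :=
  [set z | X z /\ forall z', X z' -> z'.1 * b - z'.2 <= z.1 * b - z.2].

Lemma mix_utility w a z : mixes z.1 a.1 -> a.2 = z.2 ->
  agent_utility w a = (w 0 + (z.1 * slope w - z.2))%:E.
Proof.
move=> [_ Fw] a2; rewrite agent_utilityE Fw a2 /slope; congr EFin; ring.
Qed.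

(** The agent's problem reduces to pairs of reals: [w 0] is common to all utilities, and every
    weight in [[0, 1]] is realised by an actual distribution. *)
Lemma mix_technology_argmax X w a : (forall z, X z -> 0 <= z.1 <= 1) ->
  agent_argmax (mix_technology X) w a <->
  exists2 z, best_response X (slope w) z & mixes z.1 a.1 /\ a.2 = z.2.
Proof.
move=> X01; split=> [[[z Xz [za az]] amax]|[z [Xz zmax] [za az]]].
  exists z => //; split => // z' Xz'.
  have [F' z'F'] := mixes_exists (X01 _ Xz').
  have /amax : mix_technology X (F', z'.2) by exists z'.
  by rewrite (mix_utility w za az) (@mix_utility w _ z')// lee_fin lerD2l.
split; first by exists z.
move=> b [z' Xz' [zb bz]].
by rewrite (mix_utility w za az) (mix_utility w zb bz) lee_fin lerD2l zmax.
Qed.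

(** The adversary answers with [mix_technology X]. A mixture of weight [x] leaves the principal
    [x - w 0 - x * slope w], and [w 0 >= 0] turns this into [x * (1 - slope w)]. *)
Lemma worst_case_le (c0 : R) (G : randomized_contract Y) (S : set (contracts Y))
    (X : set (R * R)) (b : R) :
  measurable S -> G S = 1%E -> 0 <= b ->
  X (0, 0) -> X (1, c0) -> (forall z, X z -> 0 <= z.1 <= 1 /\ 0 <= z.2) ->
  (forall w, S w -> best_response X (slope w) !=set0) ->
  (forall w z, S w -> best_response X (slope w) z ->
    z.1 * (1 - slope w) <= b) ->
  (worst_case (two_actions F0 c0) G <= b%:E)%E.
Proof.
move=> mS GS b0 X0 X1 Xge0 bestX payX.
have X01 z : X z -> 0 <= z.1 <= 1 by move=> /Xge0[].
apply: (@le_trans _ _ (\int[G]_w principal_payoff (mix_technology X) w)%E).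
  apply: ereal_inf_lbound; exists (mix_technology X) => //; split.
  - move=> _ [->|->]; first by exists (0, 0); [|split => //; exact: mixes_null].
    by exists (1, c0) => //; split => //; exact: mixes_known.
  - by move=> a [z /Xge0[_ z2] [[aY _] az]]; split => //; rewrite az.
  - exists (~` S); split; first exact: measurableC.
      by rewrite [LHS](probability_setC G mS) GS subee.
    move=> w /= nmax Sw; apply: nmax; have [z bz] := bestX _ Sw.
    have [F zF] := mixes_exists (X01 _ bz.1).
    by exists (F, z.2); apply/mix_technology_argmax => //; exists z.
apply: (integral_le_of_full mS GS b0) => w Sw.
apply: ge_ereal_sup => _ [a /(mix_technology_argmax _ _ X01)[z bz [za az]] <-].
rewrite (expectation_profit Y_compact Y_ge0)//; last exact: za.1.
rewrite lee_fin (mixes_mean_outcome za) za.2.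
apply: le_trans (payX _ _ Sw bz); have := contract_ge0 w 0; rewrite /slope.
by move: (X01 _ bz.1); nra.
Qed.

Local Notation linear a := (linear_contract Y_compact Y_ge0 a).

(** Here [x k] and [c k] stand for the mean outcome and the cost of an optimal action at slope
    [al k]. The adversary is reduced to incentive compatibility across slopes and to the value
    [al k - c0] of the known action. *)
Lemma worst_case_ge (c0 r : R) (G : randomized_contract Y) n (p al : nat -> R) :
  finitely_supported G n p (fun k => linear (al k)) ->
  (forall k, (k < n)%N -> 0 < p k) -> \sum_(k < n) p k = 1 ->
  (forall k, (k < n)%N -> 0 <= al k <= 1) ->
  (forall x c : nat -> R,
    (forall k, (k < n)%N -> 0 <= x k /\ 0 <= c k) ->
    (forall j k, (j < n)%N -> (k < n)%N ->
      al k * x j - c j <= al k * x k - c k) ->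
    (forall k, (k < n)%N -> al k - c0 <= al k * x k - c k) ->
    r <= \sum_(k < n) p k * ((1 - al k) * x k)) ->
  (r%:E <= worst_case (two_actions F0 c0) G)%E.
Proof.
move=> Gn p0 p1 al01 Hr; apply: le_ereal_inf_tmp => _ [A [A0A AY Amax] <-].
have al0 k : (k < n)%N -> 0 <= al k by move=> /al01/andP[].
have {}Amax := finitely_supported_ae Gn p0 Amax.
(* The default [null_action] can only be returned for [k >= n]. *)
pose a k := xget (null_action R) (agent_argmax A (linear (al k))).
have amax k : (k < n)%N -> agent_argmax A (linear (al k)) (a k).
  by move=> kn; apply: xgetPex; exact: Amax.
have aY k : (k < n)%N -> (a k).1 Y = 1%E /\ 0 <= (a k).2.
  by move=> /amax[/AY].
have utility k b : (k < n)%N -> actions Y b -> agent_utility (linear (al k)) b =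
    (al k * mean_outcome b.1 - b.2)%:E.
  by move=> kn [bY _]; rewrite agent_utilityE mean_pay_linear ?al0.
pose x k := mean_outcome (a k).1; pose c k := (a k).2.
have x0 k : (k < n)%N -> 0 <= x k.
  move=> /aY[akY _]; rewrite /x (mean_outcomeE Y_compact Y_ge0)//.
  exact: mean_pay_ge0.
have pay k : (k < n)%N -> (((1 - al k) * x k)%:E <=
    principal_payoff A (linear (al k)))%E.
  move=> kn; apply: ereal_sup_ubound; exists (a k); first exact: amax.
  have [akY _] := aY k kn.
  rewrite (expectation_profit Y_compact Y_ge0)// mean_pay_linear ?al0//.
  by congr EFin; rewrite /x; ring.
have pay0 k : (k < n)%N -> 0 <= (1 - al k) * x k.
  move=> kn; rewrite mulr_ge0 ?x0// subr_ge0.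
  by have /andP[] := al01 k kn.
apply: le_trans (finitely_supported_integral_ge Gn _ p1 _); first last.
- by move=> k kn; apply: le_trans (pay k kn); rewrite lee_fin pay0.
- exact: measurable_contract1.
apply: (@le_trans _ _ (\sum_(k < n) (p k)%:E * ((1 - al k) * x k)%:E)%E).
  under eq_bigr do rewrite -EFinM.
  rewrite sumEFin lee_fin; apply: (Hr x c) => [k kn|j k jn kn|k kn].
  - by split; [exact: x0|have [] := aY k kn].
  - have [_ /(_ (a j) (amax j jn).1)] := amax k kn.
    by rewrite !utility ?lee_fin//; exact: aY.
  - have [_ /(_ (F0, c0))] := amax k kn.
    rewrite agent_utilityE mean_pay_linear ?al0// mean_F0 mulr1.
    rewrite utility ?lee_fin//; last exact: aY.
    by apply; apply: A0A; right.
apply: lee_sum => k _; apply: lee_wpmul2l; first by rewrite lee_fin ltW ?p0.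
exact: pay.
Qed.

End binary_technologies.

(** * Logarithmic inequalities and the equation for [alpha_star] *)

Section log_lemmas.
Context (R : realType).
Implicit Types (u v x y : R).

(** This is [1 + l < expR l] at [l = ln x - ln y], multiplied by [y]: the tangent inequality for
    [ln] at [y]. *)
Lemma mul_lnB_lt x y : 0 < x -> 0 < y -> x != y -> y * (ln x - ln y) < x - y.
Proof.
move=> x0 y0 xy.
have l0 : ln x - ln y != 0.
  by rewrite subr_eq0; apply: contra_neq xy; apply: ln_inj; rewrite posrE.
have := expR_gt1Dx l0; rewrite expRB !lnK ?posrE// ltr_pdivlMr//.
by nra.
Qed.

Lemma mul_lnB_le x y : 0 < x -> 0 < y -> y * (ln x - ln y) <= x - y.
Proof.
move=> x0 y0; have [->|xy] := eqVneq x y; first by rewrite !subrr mulr0.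
exact/ltW/mul_lnB_lt.
Qed.

(** The tangent inequality at [u] gives [u - u * ln u < v - u * ln v], and [ln v <= 0] allows
    replacing [u * ln v] by [v * ln v]. *)
Lemma subr_mul_ln_lt u v : 0 < u -> u < v -> v <= 1 ->
  u - u * ln u < v - v * ln v.
Proof.
move=> u0 uv v1; have v0 := lt_trans u0 uv.
have := mul_lnB_lt v0 u0 (negbT (gt_eqF uv)).
have : (v - u) * ln v <= 0 by rewrite mulr_ge0_le0 ?subr_ge0 ?ln_le0// ltW.
by lra.
Qed.

(** In the variable [v = 1 - a] the equation involves [v - v * ln v], which is strictly increasing
    on []0, 1]]. *)
Lemma alpha_star_eqE (c0 a : R) : alpha_star_eq c0 a <->
  0 < 1 - a <= 1 /\ (1 - a) - (1 - a) * ln (1 - a) = 1 - c0.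
Proof.
rewrite /alpha_star_eq; split=> -[/andP[a0 a1] e]; split; lra.
Qed.

Lemma alpha_star_unique (c0 a b : R) :
  alpha_star_eq c0 a -> alpha_star_eq c0 b -> b = a.
Proof.
move=> /alpha_star_eqE[/andP[a0 a1] ea] /alpha_star_eqE[/andP[b0 b1] eb].
by case: (ltgtP (1 - a) (1 - b)) => [ab|ba|]; [have := subr_mul_ln_lt a0 ab b1|
  have := subr_mul_ln_lt b0 ba a1|]; lra.
Qed.


(** The tangent inequality [- s * ln s <= 1 - s] at [s = Num.sqrt u], multiplied by [2 * s]. *)
Lemma subr_mul_ln_le u : 0 < u -> u - u * ln u <= 2 * Num.sqrt u - u.
Proof.
move=> u0; set s := Num.sqrt u; have s0 : 0 < s by rewrite sqrtr_gt0.
have -> : u = s ^+ 2 by rewrite sqr_sqrtr// ltW.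
have := mul_lnB_le ltr01 s0; rewrite ln1 sub0r lnXn// mulr2n.
by move=> /(ler_wpM2l (ltW s0)); lra.
Qed.

(** Intermediate values on [[d ^+ 2, 1]], away from the singularity of [ln] at 0: [f 1 = 1], and
    [f (d ^+ 2) <= 2 * d - d ^+ 2 = 1 - c0]. The left end is the deterministic payoff. *)
Lemma alpha_star_exists (c0 : R) : 0 <= c0 < 1 -> exists a, alpha_star_eq c0 a.
Proof.
move=> /andP[c00 c01]; pose d := 1 - Num.sqrt c0; pose f u : R := u - u * ln u.
have s0 : 0 <= Num.sqrt c0 by exact: sqrtr_ge0.
have s1 : Num.sqrt c0 < 1 by rewrite -sqrtr1 ltr_sqrt.
have sc : Num.sqrt c0 ^+ 2 = c0 by exact: sqr_sqrtr.
have d0 : 0 < d by rewrite subr_gt0.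
have d1 : d ^+ 2 <= 1 by rewrite /d; nra.
have fc : {within `[d ^+ 2, 1], continuous f}.
  apply: continuous_in_subspaceT => u; rewrite inE/= in_itv/= => /andP[du _].
  have u0 : 0 < u by apply: lt_le_trans du; rewrite exprn_gt0.
  apply: cvgB; first exact: cvg_id.
  by apply: cvgM; [exact: cvg_id|exact: continuous_ln].
have fd : f (d ^+ 2) <= 1 - c0.
  have := subr_mul_ln_le (exprn_gt0 2 d0); rewrite sqrtr_sqr gtr0_norm//.
  rewrite -sc /f /d.
  by nra.
have f1 : f 1 = 1 by rewrite /f ln1 mulr0 subr0.
have [|u] := @IVT R f _ _ (1 - c0) d1 fc.
  by rewrite ge_min fd/= le_max f1 gerBl c00 orbT.
rewrite in_itv/= => /andP[du u1] fu; exists (1 - u); apply/alpha_star_eqE.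
rewrite opprB addrC subrK u1 andbT; split => //.
by apply: lt_le_trans du; rewrite exprn_gt0.
Qed.

Lemma alpha_starP (c0 : R) : 0 <= c0 < 1 -> alpha_star_eq c0 (alpha_star c0).
Proof. by move=> /alpha_star_exists/xgetPex; exact. Qed.

End log_lemmas.

(** * The adversary's logarithmic menu *)

Section worst_technology.
Context (R : realType) (v : R) (v0 : 0 < v) (v1 : v <= 1).
Implicit Types (b x : R) (z : R * R).

(** The marginal cost is [1 - v / x], so an interior choice at slope [b] satisfies
    [x * (1 - b) = v]. *)
Definition log_cost x : R := x - v - v * (ln x - ln v).

Definition log_menu : set (R * R) :=
  [set z | z = (0, 0) \/ v <= z.1 <= 1 /\ z.2 = log_cost z.1].

Lemma log_menu_ge0 z : log_menu z -> 0 <= z.1 <= 1 /\ 0 <= z.2.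
Proof.
move=> [->|[/andP[vz z1] ->]] /=; first by rewrite lexx ler01.
have z0 : 0 < z.1 by exact: lt_le_trans vz.
by rewrite ltW//= z1 /log_cost; split => //; have := mul_lnB_le z0 v0; lra.
Qed.

Lemma log_menu_best_exists b : best_response log_menu b !=set0.
Proof.
have [b0|b0] := ltP b 0.
  exists (0, 0); split; first by left.
  move=> z' Xz'; have [/andP[x0 _] c0] := log_menu_ge0 Xz'.
  by have : z'.1 * b <= 0 by [rewrite mulr_ge0_le0// ltW]; rewrite /=; lra.
pose x := if 1 - b <= v then 1 else v / (1 - b).
(* The last clause is the first-order condition multiplied by [x]: an equality in the interior, and
   at the corner [x = 1] a consequence of [y <= 1] and [1 - b <= v]. *)
have [vx x1 xP] : [/\ v <= x, x <= 1 &
    forall y, v <= y <= 1 -> v * (y - x) <= (1 - b) * (y - x) * x].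
  rewrite /x; have [bv|bv] := leP (1 - b) v.
    split=> // y /andP[vy y1]; rewrite mulr1.
    by rewrite ler_wnM2r// subr_le0.
  have b1 : 0 < 1 - b by exact: lt_trans bv.
  split; first by rewrite ler_pdivlMr// mulrBr mulr1 gerBl mulr_ge0// ltW.
    by rewrite ler_pdivrMr// mul1r ltW.
  move=> y _; rewrite le_eqVlt; apply/orP; left; apply/eqP; field.
  by rewrite gt_eqF.
have x0 : 0 < x by exact: lt_le_trans vx.
have best y : v <= y <= 1 -> y * b - log_cost y <= x * b - log_cost x.
  move=> /[dup] /xP xPy /andP[vy y1]; have y0 : 0 < y by exact: lt_le_trans vy.
  rewrite /log_cost.
  have H : v * (ln y - ln x) <= (1 - b) * (y - x).
    rewrite -(ler_pM2r x0); apply: le_trans xPy.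
    rewrite -mulrA [_ * x]mulrC.
    by apply: ler_wpM2l; [exact: ltW|exact: mul_lnB_le].
  by lra.
exists (x, log_cost x); split; first by right; rewrite /= vx x1.
move=> z' [->|[z'1 ->]]; last exact: best.
(* For [b >= 0] the null pair is dominated by weight [v], whose cost is 0. *)
apply: le_trans (best v _); last by rewrite lexx v1.
by rewrite /log_cost /= !subrr mulr0 !subr0 mul0r mulr_ge0// ltW.
Qed.

(** If the bound failed, the smaller weight [y = v / (1 - b)] would be strictly better for the
    agent, by the strict tangent inequality at [y]. Comparison with the null pair gives [b >= 0],
    which puts [y] in the menu. *)
Lemma log_menu_best_pay b z : best_response log_menu b z -> z.1 * (1 - b) <= v.
Proof.
move=> [[->|[/andP[vz z1] z2]] best]; first by rewrite mul0r ltW.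
have z0 : 0 < z.1 by exact: lt_le_trans vz.
have c0 : 0 <= z.2.
  by have [] := @log_menu_ge0 z _ => //; right; rewrite vz z1.
rewrite leNgt; apply/negP => vzb.
have b0 : 0 <= b.
  have /= := best (0, 0) (or_introl erefl); rewrite mul0r subr0 => H.
  by rewrite leNgt; apply/negP => b0; nra.
have b1 : 0 < 1 - b by rewrite -(pmulr_rgt0 _ z0) (lt_trans v0).
have [y yb] : exists y, y * (1 - b) = v.
  by exists (v / (1 - b)); rewrite divfK// gt_eqF.
have vy : v <= y.
  by rewrite -(ler_pM2r b1) yb mulrBr mulr1 gerBl mulr_ge0// ltW.
have y0 : 0 < y by exact: lt_le_trans vy.
have yz : y < z.1 by rewrite -(ltr_pM2r b1) yb.
have y1 : y <= 1 by rewrite ltW// (lt_le_trans yz).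
have /= := best (y, log_cost y) (or_intror _); rewrite vy y1 z2 /log_cost.
move=> /(_ (conj erefl erefl)).
have : v * (ln z.1 - ln y) < (1 - b) * (z.1 - y).
  rewrite -yb [y * _]mulrC -mulrA ltr_pM2l//.
  exact: mul_lnB_lt z0 y0 (negbT (gt_eqF yz)).
by lra.
Qed.

End worst_technology.

(** * The adversary's menu against a single contract *)

Section deterministic_menu.
Context (R : realType) (c0 : R) (c0_gt0 : 0 < c0).

(** The menu may depend on [b], since a point mass reveals the slope. Below [c0] the known action
    does not pay for the agent; otherwise a free mixture undercuts it. *)
Lemma cheap_menu (b e : R) : 0 < e ->
  exists X : set (R * R),
    [/\ X (0, 0), X (1, c0),
      forall z, X z -> 0 <= z.1 <= 1 /\ 0 <= z.2,
      best_response X b !=set0 &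
      forall z, best_response X b z ->
        z.1 * (1 - b) <= (1 - Num.sqrt c0) ^+ 2 + e].
Proof.
move=> e0; have sq0 : 0 <= (1 - Num.sqrt c0) ^+ 2 + e.
  by rewrite addr_ge0 ?sqr_ge0// ltW.
have [bc|cb] := ltP b c0.
  exists [set z | z = (0, 0) \/ z = (1, c0)]; split; [by left|by right| | |].
  - by move=> z [->|->] /=; rewrite !lexx ler01 ?(ltW c0_gt0).
  - exists (0, 0); split; first by left.
    by move=> z [->|->] /=; lra.
  - move=> z [[->|->]]; first by move=> _; rewrite /= mul0r.
    by move=> /(_ (0, 0) (or_introl erefl)) /=; lra.
have b0 : 0 < b by exact: lt_le_trans cb.
(* The cap [c0 / b] keeps [x <= 1]. As [d > 0], the mixture beats the known action by [d * b], so no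
   tie is left to break in favour of the principal. *)
pose d := Num.min e (c0 / b); pose x := (b - c0) / b + d.
have d0 : 0 < d by rewrite lt_min e0 divr_gt0.
have de : d <= e by rewrite ge_min lexx.
have dcb : d <= c0 / b by rewrite ge_min lexx orbT.
have xE : x = 1 - c0 / b + d by rewrite /x mulrBl divff// gt_eqF.
have cb0 : c0 / b <= 1 by rewrite ler_pdivrMr// mul1r.
have cb1 : 0 < c0 / b by rewrite divr_gt0.
have xb : x * b = b - c0 + d * b by rewrite /x; field; rewrite gt_eqF.
have db : 0 < d * b by rewrite mulr_gt0.
exists [set z | [\/ z = (0, 0), z = (1, c0) | z = (x, 0)]]; split.
- by constructor 1.
- by constructor 2.
- move=> z [->|->|->] /=; rewrite ?lexx ?ler01 ?(ltW c0_gt0)//.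
  by split => //; apply/andP; split; lra.
- exists (x, 0); split; first by constructor 3.
  by move=> z [->|->|->] /=; lra.
- move=> z [[->|->|->]] /=; first by move=> _; rewrite /= mul0r.
    by move=> /(_ (x, 0)) /= H; have := H (Or33 _ _ erefl); lra.
  move=> _; have [b1|b1] := leP 1 b.
    by apply: le_trans sq0; rewrite mulr_ge0_le0//; lra.
  set s := Num.sqrt c0; have sc : s ^+ 2 = c0 by rewrite sqr_sqrtr// ltW.
  have H : (1 - c0 / b) * (1 - b) <= (1 - s) ^+ 2.
    rewrite -subr_ge0 -sc.
    have -> : (1 - s) ^+ 2 - (1 - s ^+ 2 / b) * (1 - b) = (s - b) ^+ 2 / b.
      by field; rewrite gt_eqF.
    by rewrite divr_ge0 ?sqr_ge0// ltW.
  have : d * (1 - b) <= e by nra.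
  by rewrite xE; lra.
Qed.

End deterministic_menu.

(** * A discrete envelope inequality *)

Section geometric_grid.
Context (R : realType).

(** At slope [1 - q ^+ n.+1] the agent could deviate to the next choice [n.+1]; hence moving up one
    slope raises his value by at most [(1 - q) * q ^+ n.+1 * x n.+1]. These increments are summed by
    induction. *)
Lemma grid_telescope (q : R) (n : nat) (x c : nat -> R) :
  (forall k, (k < n.+1)%N -> 0 <= x k /\ 0 <= c k) ->
  (forall j k, (j < n.+1)%N -> (k < n.+1)%N ->
    (1 - q ^+ k.+1) * x j - c j <= (1 - q ^+ k.+1) * x k - c k) ->
  (1 - q ^+ n.+1) * x n - c n <= (1 - q) * \sum_(k < n.+1) q ^+ k * x k.
Proof.
elim: n => [|n IH] xc best.
  rewrite big_ord1 expr1 expr0 mul1r.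
  by have [_ ?] := xc 0%N isT; lra.
rewrite big_ord_recr /= mulrDr.
have IHn :
    (1 - q ^+ n.+1) * x n - c n <= (1 - q) * \sum_(k < n.+1) q ^+ k * x k.
  apply: IH => [k kn|j k jn kn]; first by apply: xc; exact: ltnW.
  by apply: best; exact: ltnW.
have := best n.+1 n (ltnSn _) (leqnSn _).
by rewrite [q ^+ n.+2]exprS; lra.
Qed.

End geometric_grid.

(** * The optimal payoffs *)

Section optimum.
Context (R : realType) (Y : set R).
Hypotheses (Y_compact : compact Y) (Y_ge0 : forall y, Y y -> 0 <= y)
  (Y_0 : Y 0).
Variable F0 : probability (measurableTypeR R) R.
Hypotheses (F0_Y : F0 Y = 1%E)
  (F0_mean : 'E_F0[fun y : measurableTypeR R => (y : R)]%E = 1%E).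
Variables (c0 : R) (c0_ge0 : 0 <= c0) (c0_lt1 : c0 < 1).

Local Notation A0 := (two_actions F0 c0).
Local Notation linear a := (linear_contract Y_compact Y_ge0 a).

Lemma opt_randomized_le a : alpha_star_eq c0 a ->
  (opt_randomized Y A0 <= (1 - a)%:E)%E.
Proof.
move=> /alpha_star_eqE[/andP[v0 v1] ve].
apply: ge_ereal_sup => _ [G _ <-].
apply: (worst_case_le Y_compact Y_ge0 Y_0 F0_Y F0_mean (S := setT)
  (X := log_menu (1 - a))) => //.
- exact: probability_setT.
- exact: ltW.
- by left.
(* At weight 1 the cost is [1 - v + v * ln v] with [v = 1 - a], which is [c0] by the equation for
   [a]. *)
- by right; rewrite /= v1 lexx /log_cost ln1; split => //; lra.
- by move=> z; exact: log_menu_ge0.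
- by move=> w _; exact: log_menu_best_exists.
- by move=> w z _; exact: log_menu_best_pay.
Qed.

Lemma opt_deterministic_le_randomized :
  (opt_deterministic Y A0 <= opt_randomized Y A0)%E.
Proof.
apply: ge_ereal_sup => _ [w _ <-]; apply: ereal_sup_ubound.
by exists (point_mass w).
Qed.

(** The known action secures the agent [a - c0] and costs are nonnegative, so the chosen mean
    outcome is at least [1 - c0 / a]. *)
Lemma opt_deterministic_ge (a : R) : 0 < a <= 1 ->
  (((1 - a) * (1 - c0 / a))%:E <= opt_deterministic Y A0)%E.
Proof.
move=> /andP[a0 a1].
apply: (@le_trans _ _ (worst_case A0 (point_mass (linear a)))).
  apply: (worst_case_ge F0_Y F0_mean
    (finitely_supported_dirac (linear a : contracts Y)) (al := fun=> a)) => //.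
  - by rewrite big_ord1.
  - by move=> k _; rewrite ltW.
  - move=> x c xc _ known; rewrite big_ord1 mul1r ler_wpM2l ?subr_ge0//.
    rewrite -(ler_pM2l a0) mulrBr mulr1 mulrCA divff ?gt_eqF// mulr1.
    by have [_ ?] := xc 0%N isT; have := known 0%N isT; lra.
by apply: ereal_sup_ubound; exists (linear a).
Qed.

Lemma opt_deterministicE :
  opt_deterministic Y A0 = ((1 - Num.sqrt c0) ^+ 2)%:E.
Proof.
have sq1 : Num.sqrt c0 < 1 by rewrite -sqrtr1 ltr_sqrt.
have c0E : 0 = c0 \/ 0 < c0 by apply/predU1P; rewrite -le_eqVlt.
apply/eqP; rewrite eq_le; apply/andP; split; case: c0E => c00.
- have -> : Num.sqrt c0 = 0 by rewrite -c00 sqrtr0.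
  rewrite subr0 expr1n; apply: le_trans (opt_deterministic_le_randomized) _.
  rewrite -[X in X%:E]subr0; apply: opt_randomized_le.
  by rewrite -c00; split; [rewrite lexx ltr01|rewrite subr0 ln1 mul0r addr0].
- apply: ge_ereal_sup => _ [w _ <-]; apply/lee_addgt0Pr => e e0.
  have [X [X0 X1 Xge0 Xbest Xpay]] := cheap_menu c00 (slope F0 w) e0.
  rewrite -EFinD; apply: (worst_case_le Y_compact Y_ge0 Y_0 F0_Y F0_mean
    (S := [set w]) (X := X)) => //.
  + exact: measurable_contract1.
  + by rewrite /point_mass /= diracE mem_set.
  + by rewrite addr_ge0 ?sqr_ge0// ltW.
  + by move=> _ ->.
  + by move=> _ z ->; exact: Xpay.
(* When [c0 = 0] the slope [Num.sqrt c0] is 0 and may not be used; small positive slopes approach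
   the value 1. *)
- have -> : Num.sqrt c0 = 0 by rewrite -c00 sqrtr0.
  rewrite subr0 expr1n; apply/lee_subgt0Pr => e e0.
  pose a := Num.min e 1.
  have a01 : 0 < a <= 1 by rewrite lt_min e0 ltr01 ge_min lexx orbT.
  apply: le_trans (opt_deterministic_ge a01).
  by rewrite -EFinB lee_fin -c00 mul0r subr0 mulr1 lerB// ge_min lexx.
- have s0 : 0 < Num.sqrt c0 by rewrite sqrtr_gt0.
  have s01 : 0 < Num.sqrt c0 <= 1 by rewrite s0 ltW.
  apply: le_trans (opt_deterministic_ge s01).
  have -> : c0 / Num.sqrt c0 = Num.sqrt c0.
    by rewrite -{1}(sqr_sqrtr c0_ge0) expr2 mulfK// gt_eqF.
  by rewrite expr2.
Qed.

Lemma opt_randomized_ge (a : R) (n : nat) : c0 <= a -> 0 < a < 1 ->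
  (((a - c0) / - ln (1 - a) * (1 - - ln (1 - a) / n.+1%:R))%:E <=
   opt_randomized Y A0)%E.
Proof.
move=> ca /andP[a0 a1]; set s := - ln (1 - a).
have s0 : 0 < s by rewrite oppr_gt0 ln_lt0// subr_gt0 a1/= gtrBl.
pose q : R := expR (- (s / n.+1%:R)).
have q0 : 0 < q by exact: expR_gt0.
have q1 : q <= 1 by rewrite expR_le1 oppr_le0 divr_ge0// ltW.
have qh : 1 - s / n.+1%:R <= q by exact: expR_ge1Dx.
have qn : q ^+ n.+1 = 1 - a.
  by rewrite -expRM_natr mulNr divfK ?pnatr_eq0// opprK lnK// posrE subr_gt0.
pose al k := 1 - q ^+ k.+1.
have n0 : 0 <= n.+1%:R^-1 :> R by rewrite invr_ge0.
pose p (_ : nat) := NngNum n0.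
have p1 : \sum_(k < n.+1) (p k)%:num = 1.
  by rewrite sumr_const card_ord -[_ *+ _]mulr_natr mulVf ?pnatr_eq0.
pose G : randomized_contract Y :=
  mixture (fun k => @dirac _ (contracts Y) (linear (al k)) R : probability _ R)
    p1.
apply: (@le_trans _ _ (worst_case A0 G)); last first.
  by apply: ereal_sup_ubound; exists G.
apply: (worst_case_ge F0_Y F0_mean (al := al) (finitely_supported_mixture _ p1)).
- by move=> k _; rewrite /= invr_gt0.
- exact: p1.
- move=> k _; rewrite subr_ge0 gerBl exprn_ge0 ?(ltW q0)// andbT.
  by rewrite exprn_ile1// ltW.
move=> x c xc best known.
(* The last slope [al n] is [a] itself, where the known action is worth [a - c0]. *)
have H := le_trans (known n (ltnSn n)) (grid_telescope xc best).
rewrite /al qn subKr in H.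
set P := (X in _ <= X).
(* The payoff at [k] carries [q ^+ k.+1] but the slope increment only [q ^+ k]; the spare factor
   [q >= 1 - s / n.+1%:R] is the discretisation loss. *)
have PE : P * (n.+1%:R * (1 - q)) = q * ((1 - q) * \sum_(k < n.+1) q ^+ k * x k).
  rewrite /P !mulr_sumr mulr_suml; apply: eq_bigr => k _.
  by rewrite /= /al subKr exprS; field; rewrite nat1r pnatr_eq0.
have P0 : 0 <= P.
  apply: sumr_ge0 => k _; rewrite /= /al subKr.
  rewrite mulr_ge0 ?invr_ge0// mulr_ge0 ?exprn_ge0 ?(ltW q0)//.
  by have [] := xc k (ltn_ord k).
have nq : n.+1%:R * (1 - q) <= s.
  have : 1 - q <= s / n.+1%:R by rewrite lerBlDr addrC -lerBlDr.
  by rewrite ler_pdivlMr// mulrC.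
rewrite mulrAC ler_pdivrMr//.
apply: (@le_trans _ _ (P * (n.+1%:R * (1 - q)))); last exact: ler_wpM2l.
rewrite PE mulrC; apply: (@le_trans _ _ (q * (a - c0))).
  by rewrite ler_wpM2r// subr_ge0.
by rewrite ler_wpM2l// ltW.
Qed.

Lemma opt_randomizedE a : alpha_star_eq c0 a ->
  opt_randomized Y A0 = (1 - a)%:E.
Proof.
move=> /[dup] aE [/andP[a0 a1] ae]; apply/eqP; rewrite eq_le opt_randomized_le//=.
(* The grid requires [a > 0]; at [a = 0] also [c0 = 0], and deterministic contracts already reach
   1. *)
have [a00|{}a0] : 0 = a \/ 0 < a by apply/predU1P; rewrite -le_eqVlt.
  apply: le_trans opt_deterministic_le_randomized; rewrite opt_deterministicE.
  by rewrite -ae -a00 subr0 ln1 mul0r addr0 sqrtr0 subr0 expr1n.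
have l0 : ln (1 - a) < 0 by rewrite ln_lt0// subr_gt0 a1/= gtrBl.
have ac : a - c0 = (1 - a) * - ln (1 - a) by lra.
have ca : c0 <= a by rewrite -subr_ge0 ac mulr_ge0 ?oppr_ge0 ?subr_ge0 ?ltW.
apply/lee_subgt0Pr => e e0.
have [n en] : exists n, (1 - a) * - ln (1 - a) / e < n.+1%:R.
  by exists (Num.truncn ((1 - a) * - ln (1 - a) / e)); exact: truncnS_gt.
have a01 : 0 < a < 1 by rewrite a0 a1.
apply: le_trans (opt_randomized_ge n ca a01).
rewrite ac mulfK ?oppr_eq0 ?lt_eqF// -EFinB lee_fin mulrBr mulr1 lerB//.
by rewrite mulrA ler_pdivrMr// [e * _]mulrC -ler_pdivrMr// ltW.
Qed.

End optimum.

(** * Maximisation of the quotient and divergence of the payoff ratio *)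

Section alpha_quotient.
Context (R : realType).
Implicit Types a b : R.

(** The tangent inequality between [1 - b] and 1, used in both directions. *)
Lemma neg_ln_bounds b : 0 < b < 1 ->
  b <= - ln (1 - b) /\ - ln (1 - b) * (1 - b) <= b.
Proof.
move=> /andP[b0 b1]; have b10 : 0 < 1 - b by rewrite subr_gt0.
have := mul_lnB_le b10 ltr01; have := mul_lnB_le ltr01 b10; rewrite ln1.
by split; lra.
Qed.

Lemma neg_ln_gt0 b : 0 < b < 1 -> 0 < - ln (1 - b).
Proof. by move=> /[dup] /andP[b0 _] /neg_ln_bounds[+ _]; exact: lt_le_trans. Qed.

Lemma cvg_alpha_quotient0 :
  (((b - 0) / - ln (1 - b))%:E @[b --> (0 : R)^'+] --> 1%E)%E.
Proof.
apply: cvg_EFin; first exact: nearW.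
apply: (@squeeze_cvgr _ _ _ _ (fun b : R => 1 - b) (fun=> 1)).
- near=> b.
  have b01 : 0 < b < 1.
    by apply/andP; split; near: b; [exact: nbhs_right_gt|exact: nbhs_right_lt].
  have [H1 H2] := neg_ln_bounds b01; have s0 := neg_ln_gt0 b01.
  by rewrite /= subr0 ler_pdivlMr// ler_pdivrMr// mul1r mulrC H2 H1.
- rewrite -[X in _ --> X]subr0; apply: cvgB; first exact: cvg_cst.
  by apply: cvg_at_right_filter; exact: cvg_id.
- exact: cvg_cst.
Unshelve. all: by end_near. Qed.

Lemma cvg_alpha_quotientNy (c0 : R) : 0 < c0 ->
  (((b - c0) / - ln (1 - b))%:E @[b --> (0 : R)^'+] --> -oo)%E.
Proof.
move=> c00; apply/cvgeNyPle => A; near=> b.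
have b0 : 0 < b by near: b; exact: nbhs_right_gt.
have b2 : b < 2^-1 by near: b; apply: nbhs_right_lt; rewrite invr_gt0.
have bc : b < c0 / 2 by near: b; apply: nbhs_right_lt; rewrite divr_gt0.
(* With [- ln (1 - b) <= 2 * b] this keeps [A * - ln (1 - b)] above [- c0 / 2], while the numerator
   is below [- c0 / 2]. *)
have bA : b < c0 / (4 * (`|A| + 1)).
  by near: b; apply: nbhs_right_lt; rewrite divr_gt0// mulr_gt0// ltr_wpDl.
have b01 : 0 < b < 1 by rewrite b0 (lt_trans b2)// invf_lt1// ltr1n.
have [_ H2] := neg_ln_bounds b01; have s0 := neg_ln_gt0 b01.
rewrite lee_fin ler_pdivrMr//.
have s2 : - ln (1 - b) <= 2 * b by nra.
have A1 : 0 < `|A| + 1 by rewrite ltr_wpDl.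
have : b * (4 * (`|A| + 1)) < c0 by rewrite -ltr_pdivlMr// mulr_gt0.
have : - (`|A| + 1) <= A by have := ler_norm (- A); rewrite normrN; lra.
move: (`|A| + 1) A1 => B B0 AB Bb.
have : B * - ln (1 - b) <= B * (2 * b) by rewrite ler_wpM2l// ltW.
have : - B * - ln (1 - b) <= A * - ln (1 - b) by rewrite ler_wpM2r// ltW.
by lra.
Unshelve. all: by end_near. Qed.

Lemma alpha_quotient_star (c0 a : R) : alpha_star_eq c0 a ->
  alpha_quotient c0 a = (1 - a)%:E.
Proof.
move=> [/andP[a0 a1] ae]; rewrite /alpha_quotient; case: eqVneq => [a00|an0].
  rewrite -ae a00 subr0 ln1 mul0r addr0.
  by apply/cvg_lim => //; exact: cvg_alpha_quotient0.
have a01 : 0 < a < 1 by rewrite lt_def an0 a0.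
rewrite -ae opprD addrA subrr add0r -mulNr [_ * (1 - a)]mulrC mulfK// gt_eqF//.
exact: neg_ln_gt0.
Qed.

(** For [b != 0] this is the tangent inequality for [ln] at [1 - a], evaluated at [1 - b]. At
    [b = 0] the limit is 1 or [-oo] according to [c0]. *)
Lemma alpha_quotient_le (c0 a b : R) : alpha_star_eq c0 a -> 0 <= c0 ->
  0 <= b < 1 -> (alpha_quotient c0 b <= alpha_quotient c0 a)%E.
Proof.
move=> /[dup] aE /[dup] /alpha_quotient_star -> [/andP[a0 a1] ae] c0_ge0 b01.
rewrite /alpha_quotient; case: eqVneq => [_|bn0].
  have [c00|c00] : 0 = c0 \/ 0 < c0 by apply/predU1P; rewrite -le_eqVlt.
    have -> : a = 0.
      apply: (@alpha_star_unique _ c0) => //.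
      by split; [rewrite lexx ltr01|rewrite subr0 ln1 mul0r addr0].
    by rewrite -c00 (cvg_lim _ cvg_alpha_quotient0)// subr0.
  by rewrite (cvg_lim _ (cvg_alpha_quotientNy c00))// leNye.
have {}b01 : 0 < b < 1 by have /andP[b0 ->] := b01; rewrite lt_def bn0 b0.
rewrite lee_fin ler_pdivrMr ?neg_ln_gt0//.
have v0 : 0 < 1 - a by rewrite subr_gt0.
have u0 : 0 < 1 - b by have /andP[_] := b01; rewrite subr_gt0.
by have := mul_lnB_le u0 v0; lra.
Qed.

(** With [v = 1 - a] and [r] its fourth root, [1 - c0 = r ^+ 3 * (r * (1 - ln v)) <= 4 * r ^+ 3];
    squaring gives at most [16 * v * Num.sqrt v], and [v <= 1 - c0]. *)
Lemma payoff_ratio_ge (c0 a : R) : 0 <= c0 < 1 -> alpha_star_eq c0 a ->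
  (16 * Num.sqrt (1 - c0))^-1 <= (1 - a) / (1 - Num.sqrt c0) ^+ 2.
Proof.
move=> /andP[c00 c01] /alpha_star_eqE[/andP[v0 v1] ve].
move: (1 - a) v0 v1 ve => v v0 v1 ve.
have s0 : 0 <= Num.sqrt c0 by exact: sqrtr_ge0.
have s1 : Num.sqrt c0 < 1 by rewrite -sqrtr1 ltr_sqrt.
have sc : Num.sqrt c0 ^+ 2 = c0 by exact: sqr_sqrtr.
have y0 : 0 < 1 - c0 by rewrite subr_gt0.
set t := Num.sqrt (1 - c0); have t0 : 0 < t by rewrite sqrtr_gt0.
have vy : v <= 1 - c0.
  by have : v * ln v <= 0 by [rewrite mulr_ge0_le0 ?ln_le0// ltW]; lra.
set w := Num.sqrt v; have w0 : 0 < w by rewrite sqrtr_gt0.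
have wv : v = w ^+ 2 by rewrite sqr_sqrtr// ltW.
have wt : w <= t by rewrite ler_wsqrtr.
(* Absorbing the logarithm into [w] would only bound the ratio below by a constant; the fourth root
   leaves a spare factor [w <= t]. *)
set r := Num.sqrt w; have r0 : 0 < r by rewrite sqrtr_gt0.
have rw : w = r ^+ 2 by rewrite sqr_sqrtr// ltW.
have lv : ln v = 4 * ln r by rewrite wv rw !lnXn ?exprn_gt0//; lra.
have rl : r * (1 - ln v) <= 4.
  by have := mul_lnB_le ltr01 r0; rewrite ln1 lv; lra.
have l0 : 1 <= 1 - ln v by rewrite lerBrDr gerDl ln_le0.
have yw : (1 - c0) ^+ 2 <= 16 * v * t.
  have yE : 1 - c0 = r ^+ 3 * (r * (1 - ln v)).
    by rewrite -ve {1 2}wv rw; ring.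
  have : (r * (1 - ln v)) ^+ 2 <= 4 ^+ 2.
    by rewrite lerXn2r// nnegrE ?mulr_ge0 ?(ltW r0)// (le_trans ler01).
  move=> /(ler_wpM2l (exprn_ge0 6 (ltW r0))).
  have : v * w <= v * t by rewrite ler_wpM2l// ltW.
  by rewrite yE wv rw; lra.
have d0 : 0 < 1 - Num.sqrt c0 by rewrite subr_gt0.
have dy : (1 - Num.sqrt c0) ^+ 2 <= (1 - c0) ^+ 2.
  by rewrite lerXn2r ?nnegrE ?(ltW d0) ?(ltW y0)//; nra.
rewrite ler_pdivlMr ?exprn_gt0// mulrC ler_pdivrMr ?mulr_gt0//.
by apply: (le_trans dy); apply: (le_trans yw); lra.
Qed.

Lemma cvg_payoff_ratio :
  (1 - alpha_star c0) / (1 - Num.sqrt c0) ^+ 2 @[c0 --> (1 : R)^'-] --> +oo.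
Proof.
apply/cvgryPge => A; near=> c0.
pose B := `|A| + 1; have B0 : 0 < B by rewrite /B ltr_wpDl.
have c01 : 0 <= c0 < 1.
  apply/andP; split; last by near: c0; exact: nbhs_left_lt.
  by apply: ltW; near: c0; apply: nbhs_left_gt.
(* This threshold makes [16 * Num.sqrt (1 - c0)] at most [B^-1]. *)
have c0B : 1 - (16 * B)^-1 ^+ 2 < c0.
  near: c0; apply: nbhs_left_gt.
  by rewrite gtrBl exprn_gt0// invr_gt0 mulr_gt0// ltr_wpDl.
apply: le_trans (payoff_ratio_ge c01 (alpha_starP c01)).
have t0 : 0 < Num.sqrt (1 - c0) by rewrite sqrtr_gt0 subr_gt0; case/andP: c01.
have tB : Num.sqrt (1 - c0) <= (16 * B)^-1.
  rewrite -[leRHS]ger0_norm ?invr_ge0 ?mulr_ge0 ?(ltW B0)//.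
  by rewrite -sqrtr_sqr ler_wsqrtr//; lra.
apply: (@le_trans _ _ B); first by rewrite /B (le_trans (ler_norm _))// lerDl.
rewrite -[leLHS]invrK lef_pV2 ?posrE ?invr_gt0 ?mulr_gt0//.
by rewrite -ler_pdivlMl// -invfM.
Unshelve. all: by end_near. Qed.

End alpha_quotient.

Theorem mainTheorem2 (R : realType) (Y : set R)
    (Y_compact : compact Y) (Y_ge0 : forall y, Y y -> 0 <= y) (Y_0 : Y 0)
    (F0 : probability (measurableTypeR R) R) (F0_Y : F0 Y = 1%E)
    (F0_mean : 'E_F0[fun y : measurableTypeR R => (y : R)]%E = 1%E) :
  [/\ (forall c0 : R, 0 <= c0 < 1 ->
        let A0 := two_actions F0 c0 in
        let a := alpha_star c0 in
        [/\ alpha_star_eq c0 a /\ (forall b, alpha_star_eq c0 b -> b = a),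
            opt_randomized Y A0 = alpha_quotient c0 a /\
              (forall b, 0 <= b < 1 ->
                (alpha_quotient c0 b <= alpha_quotient c0 a)%E),
            alpha_quotient c0 a = (1 - a)%:E,
            opt_deterministic Y A0 = ((1 - Num.sqrt c0) ^+ 2)%:E &
            fine (opt_randomized Y A0) / fine (opt_deterministic Y A0) =
              (1 - a) / (1 - Num.sqrt c0) ^+ 2]),
      ((1 - alpha_star c0) / (1 - Num.sqrt c0) ^+ 2 @[c0 --> (1 : R)^'-]
         --> +oo) &
      (forall M : R, exists2 c0 : R, 0 <= c0 < 1 &
        M < fine (opt_randomized Y (two_actions F0 c0)) /
            fine (opt_deterministic Y (two_actions F0 c0)))].
Proof.
have optE c0 : 0 <= c0 < 1 ->
    opt_randomized Y (two_actions F0 c0) = (1 - alpha_star c0)%:E /\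
    opt_deterministic Y (two_actions F0 c0) = ((1 - Num.sqrt c0) ^+ 2)%:E.
  move=> /[dup] c01 /andP[c00 c0_1]; split.
    exact: (opt_randomizedE Y_compact Y_ge0 Y_0 F0_Y F0_mean c00 c0_1
      (alpha_starP c01)).
  exact: (opt_deterministicE Y_compact Y_ge0 Y_0 F0_Y F0_mean c00 c0_1).
split.
- move=> c0 c01 A0 a; have aE : alpha_star_eq c0 a := alpha_starP c01.
  have [randE detE] := optE c0 c01.
  split.
  + by split=> // b; exact: alpha_star_unique.
  + rewrite (alpha_quotient_star aE); split=> // b b01.
    rewrite -(alpha_quotient_star aE); apply: alpha_quotient_le => //.
    by case/andP: c01.
  + exact: alpha_quotient_star.
  + exact: detE.
  + by rewrite /A0 randE detE.
- exact: cvg_payoff_ratio.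
(* Divergence of the ratio supplies the witness, any [c0] close enough to 1 from the left. *)
- move=> M; near (1 : R)^'- => c0.
  have c01 : 0 <= c0 < 1.
    apply/andP; split; last by near: c0; exact: nbhs_left_lt.
    by apply: ltW; near: c0; apply: nbhs_left_gt.
  exists c0 => //; have [-> ->] := optE c0 c01; rewrite /=.
  by near: c0; move: M; apply/cvgryPgt; exact: cvg_payoff_ratio.
Unshelve. all: by end_near. Qed.
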